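(* Let $X$ be a topological space. (1) The following are equivalent: (a) $X$ is Markov $\omega$-Menger; (b) $X$ is Markov Menger; (c) $X$ is $\sigma$-relatively compact. (2) The following are equivalent: (a) $X$ is Markov $\omega$-Rothberger; (b) $X$ is Markov Rothberger; (c) $X$ is topologically countable.
   Context: No separation axioms are assumed. $\mathcal O_X$ denotes the set of all open covers of $X$, and $\Omega_X$ the set of all $\omega$-covers of $X$, i.e. open covers $\mathscr U$ of $X$ such that every finite subset of $X$ is contained in a member of $\mathscr U$. $[S]^{<\omega}$ is the set of finite subsets of $S$. For $\mathcal A\in\{\mathcal O_X,\Omega_X\}$, in the game $\mathsf G_1(\mathcal A,\mathcal A)$ (resp. $\mathsf G_{\mathrm{fin}}(\mathcal A,\mathcal A)$), in round $n\in\omega$ P1 plays $\mathscr U_n\in\mathcal A$ and P2 responds with $U_n\in\mathscr U_n$ (resp. $\mathscr F_n\in[\mathscr U_n]^{<\omega}$). P2 wins if $\{U_n:n\in\omega\}\in\mathcal A$ (resp. $\bigcup\{\mathscr F_n:n\in\omega\}\in\mathcal A$); otherwise P1 wins. A Markov strategy for P2 is a function $\sigma$ on $\mathcal A\times\omega$ with $\sigma(\mathscr U,n)\in\mathscr U$ (resp. $\sigma(\mathscr U,n)\in[\mathscr U]^{<\omega}$), with P2 responding to $\mathscr U_n$ in round $n$ by $\sigma(\mathscr U_n,n)$; it is winning if P2 wins every run played this way. $X$ is Markov Menger, Markov $\omega$-Menger, Markov Rothberger, Markov $\omega$-Rothberger if P2 has a winning Markov strategy in $\mathsf G_{\mathrm{fin}}(\mathcal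 O_X,\mathcal O_X)$, $\mathsf G_{\mathrm{fin}}(\Omega_X,\Omega_X)$, $\mathsf G_1(\mathcal O_X,\mathcal O_X)$, $\mathsf G_1(\Omega_X,\Omega_X)$, respectively. A subset $A\subseteq X$ is relatively compact (in $X$) if every open cover of $X$ admits a finite subset which covers $A$. $X$ is $\sigma$-relatively compact if there is a countable collection $\{A_n:n\in\omega\}$ of relatively compact subsets of $X$ with $X=\bigcup_{n\in\omega}A_n$. For $x\in X$, $\mathcal N_x$ is the set of open sets containing $x$. $X$ is topologically countable if there exists $\{x_n:n\in\omega\}\subseteq X$ such that $X=\bigcup_{n\in\omega}\bigcap\mathcal N_{x_n}$.
   Formalization: Part (2) is stated for nonempty X only; for the empty space it fails, since the empty family is an open cover to which P2 has no reply, while the only ω-cover is {∅}, so X is Markov ω-Rothberger but not Markov Rothberger. *)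

(* Defs.v *)
From mathcomp Require Import all_boot.
From mathcomp Require Import boolp classical_sets functions cardinality.
From mathcomp Require Import topology.

Set Implicit Arguments.
Unset Strict Implicit.
Unset Printing Implicit Defensive.

Local Open Scope classical_set_scope.

Section Covers.
Context {X : topologicalType}.
Implicit Types (U : set (set X)) (A : set X).

Definition is_open_cover U : Prop :=
  U `<=` open /\ \bigcup_(V in U) V = [set: X].

Definition is_omega_cover U : Prop :=
  is_open_cover U /\
  forall F : set X, finite_set F -> exists2 V, U V & F `<=` V.

Definition relatively_compact A : Prop :=
  forall U, is_open_cover U ->
    exists F : set (set X),
      [/\ finite_set F, F `<=` U & A `<=` \bigcup_(V in F) V].

End Covers.

Definition open_covers (X : topologicalType) : set (set (set X)) :=
  [set U | is_open_cover U].

Definition omega_covers (X : topologicalType) : set (set (set X)) :=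
  [set U | is_omega_cover U].

Arguments open_covers : clear implicits.
Arguments omega_covers : clear implicits.

Section Games.
Context {X : topologicalType}.
Implicit Types (AA BB : set (set (set X))).

(* Strategies are total functions, but legality and the winning condition only
   involve their values on members of AA. *)

Definition markov_strategy1 AA (sigma : set (set X) -> nat -> set X) : Prop :=
  forall U n, AA U -> U (sigma U n).

Definition P2_wins1 BB (choice : nat -> set X) : Prop := BB (range choice).

(* P2 has a winning Markov strategy in G_1(AA, BB) *)
Definition markov_win1 AA BB : Prop :=
  exists2 sigma, markov_strategy1 AA sigma &
    forall U : nat -> set (set X), (forall n, AA (U n)) ->
      P2_wins1 BB (fun n => sigma (U n) n).

Definition markov_strategy_fin AA
    (sigma : set (set X) -> nat -> set (set X)) : Prop :=
  forall U n, AA U -> finite_set (sigma U n) /\ sigma U n `<=` U.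

Definition P2_wins_fin BB (choice : nat -> set (set X)) : Prop :=
  BB (\bigcup_n choice n).

(* P2 has a winning Markov strategy in G_fin(AA, BB) *)
Definition markov_win_fin AA BB : Prop :=
  exists2 sigma, markov_strategy_fin AA sigma &
    forall U : nat -> set (set X), (forall n, AA (U n)) ->
      P2_wins_fin BB (fun n => sigma (U n) n).

End Games.

Section Properties.
Variable X : topologicalType.

Definition markov_Menger : Prop :=
  markov_win_fin (open_covers X) (open_covers X).

Definition markov_omega_Menger : Prop :=
  markov_win_fin (omega_covers X) (omega_covers X).

Definition markov_Rothberger : Prop :=
  markov_win1 (open_covers X) (open_covers X).

Definition markov_omega_Rothberger : Prop :=
  markov_win1 (omega_covers X) (omega_covers X).

Definition sigma_relatively_compact : Prop :=
  exists A : nat -> set X,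
    (forall n, relatively_compact (A n)) /\ [set: X] = \bigcup_n A n.

(* [open_nbhs x] is the set of open sets containing [x] *)
Definition topologically_countable : Prop :=
  exists x : nat -> X,
    [set: X] = \bigcup_n \bigcap_(V in open_nbhs (x n)) V.

End Properties.

(* Main.v *)
(** Everything is read off the cores [A_n], the intersection over all admissible
    covers [U] of what P2 captures when answering [U] in round [n]. If P2 wins,
    the cores cover [X]: a point outside all of them would yield a run that
    misses it. In the finite-selection games each core is relatively compact
    (for omega-covers, by closing a cover under finite unions). In the
    single-selection games each core lies in a finite union of sets
    [\bigcap N_x], since otherwise the open sets not containing the core would
    form an admissible cover.
    Conversely, relative compactness passes to finite powers by a tube-lemma
    argument, so that finitely many members of an omega-cover capture all
    [k]-tuples of a relatively compact set. If [X] is the union of the sets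
    [\bigcap N_(x_n)], then an open set containing suitable finitely many [x_n]
    contains a given finite set, and there are only countably many finite sets of
    points [x_n] to handle, one per round. *)
Require Import Defs.
From mathcomp Require Import all_boot.
From mathcomp Require Import boolp classical_sets functions cardinality topology.

Local Open Scope classical_set_scope.

(** * Cores of Markov strategies, and omega-covers tested on lists *)

Section Cores.
Context {X : topologicalType}.
Implicit Types (U : set (set X)) (A : set X) (AA : set (set (set X))).

Lemma bigcup_cores AA (phi : set (set X) -> nat -> set X) :
  (forall u, (forall n, AA (u n)) -> \bigcup_n phi (u n) n = [set: X]) ->
  [set: X] = \bigcup_n \bigcap_(U in AA) phi U n.
Proof.
move=> phiT; apply/esym/seteqP; split=> // x _.
apply: contrapT => xN.
have /choice[u uP] : forall n, exists U, AA U /\ ~ phi U n x.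
  move=> n; apply: contrapT => nU; apply: xN; exists n => // U AU.
  by apply: contrapT => nphi; apply: nU; exists U.
have [n _] : (\bigcup_n phi (u n) n) x.
  by rewrite phiT// => n; have [] := uP n.
by have [] := uP n.
Qed.

Lemma markov_win_fin_cores {AA BB} : BB `<=` open_covers X ->
  markov_win_fin AA BB ->
  exists2 sigma, markov_strategy_fin AA sigma &
    [set: X] = \bigcup_n \bigcap_(U in AA) \bigcup_(V in sigma U n) V.
Proof.
move=> BBo [sigma sigmaP win]; exists sigma => //.
apply: (@bigcup_cores AA (fun U n => \bigcup_(V in sigma U n) V)) => u Au.
have [_ /seteqP[_ covU]] := BBo _ (win u Au).
apply/seteqP; split=> // x /covU[V [n _ nV] Vx].
by exists n => //; exists V.
Qed.

Lemma markov_win1_cores {AA BB} : BB `<=` open_covers X ->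
  markov_win1 AA BB ->
  exists2 sigma, markov_strategy1 AA sigma &
    [set: X] = \bigcup_n \bigcap_(U in AA) sigma U n.
Proof.
move=> BBo [sigma sigmaP win]; exists sigma => //.
apply: bigcup_cores => u Au.
by have [_] := BBo _ (win u Au); rewrite bigcup_image.
Qed.

Lemma sub_omega_covers : omega_covers X `<=` open_covers X.
Proof. by move=> U []. Qed.

(** Lists stand for finite sets so that later proofs can use induction and lengths; the covering
    clause follows from one-point lists. *)
Lemma omega_coverP U :
  is_omega_cover U <-> U `<=` open /\
    forall s : seq X, exists2 V, U V & [set` s] `<=` V.
Proof.
split=> [[[Uo _] Uw]|[Uo Uw]].
  by split=> // s; apply: Uw; exact: finite_seq.
split; last by move=> F /finite_seqP[s ->].
split=> //; apply/seteqP; split=> // x _.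
have [V UV sV] := Uw [:: x].
by exists V => //; apply: sV; rewrite /= mem_head.
Qed.

End Cores.

(** * Finite selections and relative compactness *)

Section Menger.
Context {X : topologicalType}.
Implicit Types (U : set (set X)) (A : set X).

Definition finite_unions U : set (set X) :=
  [set W | exists F, [/\ finite_set F, F `<=` U & W = \bigcup_(V in F) V]].

Lemma finite_unions_omega_cover U :
  is_open_cover U -> is_omega_cover (finite_unions U).
Proof.
move=> [Uo Uc]; apply/omega_coverP; split.
  by move=> _ [F [_ FU ->]]; apply: bigcup_open => V /FU/Uo.
elim=> [|x s [_ [F [Ffin FU ->]] sF]].
  by exists (\bigcup_(V in set0) V) => //; exists set0; split.
have [V UV Vx] : (\bigcup_(V in U) V) x by rewrite Uc.
exists (\bigcup_(W in V |` F) W).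
  exists (V |` F); split=> //; first by rewrite finite_setU; split.
  by move=> W [->|/FU].
move=> y /=; rewrite in_cons => /orP[/eqP->|ys]; first by exists V => //; left.
by have [W FW Wy] := sF y ys; exists W => //; right.
Qed.

(** This turns an answer to [finite_unions U] into a finite part of [U] that captures at least as
    much. *)
Lemma finite_sub_finite_unions U (G : set (set X)) :
  finite_set G -> G `<=` finite_unions U ->
  exists F, [/\ finite_set F, F `<=` U &
    \bigcup_(W in G) W `<=` \bigcup_(V in F) V].
Proof.
move=> Gfin GU.
have /choice[F FP] : forall W, exists F, G W ->
    [/\ finite_set F, F `<=` U & W = \bigcup_(V in F) V].
  move=> W; have [GW|nGW] := pselect (G W); last by exists set0.
  by have [F FP] := GU _ GW; exists F.
exists (\bigcup_(W in G) F W); split.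
- by apply: bigcup_finite => // W /FP[].
- by move=> V [W /FP[_ + _]]; apply.
- move=> x [W GW]; have [_ _ WE] := FP _ GW.
  by rewrite {1}WE => -[V FV Vx]; exists V => //; exists W.
Qed.

Lemma relatively_compactU A B : relatively_compact A ->
  relatively_compact B -> relatively_compact (A `|` B).
Proof.
move=> cA cB U Uc.
have [F [Ffin FU AF]] := cA _ Uc; have [G [Gfin GU BG]] := cB _ Uc.
exists (F `|` G); split; first by rewrite finite_setU; split.
  by rewrite subUset.
by rewrite bigcup_setU; apply: setUSS.
Qed.

(** With increasing sets, every finite subset of the space lies in [B n] for all large [n]. *)
Lemma sigma_relatively_compact_nondecreasing :
  sigma_relatively_compact X ->
  exists B : nat -> set X, [/\ forall n, relatively_compact (B n),
    forall m n, m <= n -> B m `<=` B n & [set: X] = \bigcup_n B n].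
Proof.
move=> [A [cA AT]].
pose B := fix B n := if n is m.+1 then B m `|` A n else A 0.
exists B; split.
- by elim=> [|n IHn]; [exact: cA|exact: relatively_compactU].
- move=> m n; elim: n => [|n IHn]; first by rewrite leqn0 => /eqP->.
  rewrite leq_eqVlt => /orP[/eqP->//|mn].
  by apply: subset_trans (IHn mn) _; exact: subsetUl.
- apply/esym/seteqP; split=> // x; rewrite AT => -[n _ Anx].
  by exists n => //; case: n Anx => [//|n] Anx; right.
Qed.

Lemma open_bigcap_finite (F : set (set X)) :
  finite_set F -> F `<=` open -> open (\bigcap_(V in F) V).
Proof.
move=> /finite_seqP[s ->] so; rewrite bigcap_seq big_seq.
by apply: big_ind => //; [exact: openT|exact: openI].
Qed.

(* Tube lemma: relative compactness of the power [A^k] in [X^k], for covers by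
   cubes [V^k]. *)
Lemma relatively_compact_tuples A k U : relatively_compact A ->
  U `<=` open ->
  (forall s : seq X, size s <= k -> exists2 V, U V & [set` s] `<=` V) ->
  exists F, [/\ finite_set F, F `<=` U &
    forall s : seq X, size s <= k -> [set` s] `<=` A ->
      exists2 V, F V & [set` s] `<=` V].
Proof.
move=> cA; elim: k U => [|k IHk] U Uo Uk.
  have [V UV _] := Uk [::] isT.
  exists [set V]; split=> // [|s s0 _]; first by move=> _ ->.
  by exists V => //; move: s0; rewrite leqn0 => /nilP ->.
have [V0 UV0 _] := Uk [::] isT.
(* Any point of the tube [W] can be prepended to a list of length at most [k] in [A], and some
   member of [H] still captures the result. *)
pose slice W H := [/\ finite_set H, H `<=` U, forall V, H V -> W `<=` V &
  forall s : seq X, size s <= k -> [set` s] `<=` A ->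
    exists2 V, H V & [set` s] `<=` V].
have Oc : is_open_cover [set W | open W /\ exists H, slice W H].
  split=> [W []//|]; apply/seteqP; split=> // x _.
  (* The members of [U] containing [x] satisfy the hypothesis for [k], since [x] can be prepended to
     each list. *)
  have [|s sk|H [Hfin HU Hk]] := IHk [set V | U V /\ V x].
  - by move=> V [/Uo].
  - have [V UV sV] := Uk (x :: s) sk.
    exists V; first by split=> //; apply: sV; rewrite /= mem_head.
    by move=> y ys; apply: sV; rewrite /= in_cons; apply/orP; right.
  exists (\bigcap_(V in H) V); last by move=> V /HU[].
  split; first by apply: open_bigcap_finite => // V /HU[/Uo].
  exists H; split=> //; first by move=> V /HU[].
  by move=> V HV y; apply.
have [G [Gfin GO AG]] := cA _ Oc.
have /choice[H HP] : forall W, exists H, G W -> slice W H.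
  move=> W; have [/GO[_ [H WH]]|nGW] := pselect (G W); first by exists H.
  by exists set0.
(* [V0] serves the empty list, since [G] may be empty. *)
exists (V0 |` \bigcup_(W in G) H W); split.
- by rewrite finite_setU; split=> //; apply: bigcup_finite => // W /HP[].
- by move=> V [->//|[W /HP[_ HU _ _]]]; exact: HU.
- move=> [|a s] sk sA; first by exists V0; [left|].
  have [W GW Wa] : (\bigcup_(W in G) W) a by apply/AG/sA; rewrite /= mem_head.
  have [_ _ WH /(_ s sk)[|V HV sV]] := HP W GW.
    by move=> y ys; apply: sA; rewrite /= in_cons; apply/orP; right.
  exists V; first by right; exists W.
  by move=> y /=; rewrite in_cons => /orP[/eqP->|/sV//]; exact: (WH V HV).
Qed.

Lemma sigma_relatively_compact_markov_omega_Menger :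
  sigma_relatively_compact X -> markov_omega_Menger X.
Proof.
move=> /sigma_relatively_compact_nondecreasing[B [cB leB BT]].
(* Round [n] handles the lists of length at most [n] in [B n]; each list qualifies in some round. *)
have /choice[sigma sigmaP] : forall p : set (set X) * nat, exists F,
    is_omega_cover p.1 -> [/\ finite_set F, F `<=` p.1 &
      forall s : seq X, size s <= p.2 -> [set` s] `<=` B p.2 ->
        exists2 V, F V & [set` s] `<=` V].
  move=> [U n] /=; have [/omega_coverP[Uo Uw]|nU] := pselect (is_omega_cover U).
    have [//|F FP] := relatively_compact_tuples _ n _ (cB n) Uo.
    by exists F.
  by exists set0.
exists (fun U n => sigma (U, n)) => [U n AU|u uw].
  by have [] := sigmaP (U, n) AU.
apply/omega_coverP; split.
  move=> V [n _]; have [_ + _] := sigmaP (u n, n) (uw n).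
  by have [[uo _] _] := uw n => /[apply] /uo.
move=> s.
have [m sm] : exists m, [set` s] `<=` B m.
  elim: s => [|x s [m sm]]; first by exists 0.
  have [n _ Bnx] : (\bigcup_n B n) x by rewrite -BT.
  exists (maxn m n) => y /=; rewrite in_cons => /orP[/eqP->|/sm].
    by apply: leB Bnx; exact: leq_maxr.
  by apply: leB; exact: leq_maxl.
set n := maxn m (size s).
have [_ _ /(_ s (leq_maxr _ _))[|V FV sV]] := sigmaP (u n, n) (uw n).
  by apply: subset_trans sm _; apply: leB; exact: leq_maxl.
by exists V => //; exists n.
Qed.

Lemma sigma_relatively_compact_markov_Menger :
  sigma_relatively_compact X -> markov_Menger X.
Proof.
move=> [A [cA AT]].
have /choice[sigma sigmaP] : forall p : set (set X) * nat, exists F,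
    is_open_cover p.1 -> [/\ finite_set F, F `<=` p.1 &
      A p.2 `<=` \bigcup_(V in F) V].
  move=> [U n] /=; have [Uc|nU] := pselect (is_open_cover U).
    by have [F FP] := cA n U Uc; exists F.
  by exists set0.
exists (fun U n => sigma (U, n)) => [U n AU|u uc].
  by have [] := sigmaP (U, n) AU.
split.
  move=> V [n _]; have [_ + _] := sigmaP (u n, n) (uc n).
  by have [uo _] := uc n => /[apply] /uo.
apply/seteqP; split=> // x; rewrite AT => -[n _].
have [_ _ /[apply] -[V FV Vx]] := sigmaP (u n, n) (uc n).
by exists V => //; exists n.
Qed.

Lemma markov_Menger_sigma_relatively_compact :
  markov_Menger X -> sigma_relatively_compact X.
Proof.
move=> /(markov_win_fin_cores (@subset_refl _ _))[sigma sigmaP coresT].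
exists (fun n => \bigcap_(U in open_covers X) \bigcup_(V in sigma U n) V).
split=> // n U Uc; have [sfin sU] := sigmaP U n Uc.
by exists (sigma U n); split=> // x /(_ U Uc).
Qed.

Lemma markov_omega_Menger_sigma_relatively_compact :
  markov_omega_Menger X -> sigma_relatively_compact X.
Proof.
move=> /(markov_win_fin_cores sub_omega_covers)[sigma sigmaP coresT].
exists (fun n => \bigcap_(U in omega_covers X) \bigcup_(V in sigma U n) V).
split=> // n U /finite_unions_omega_cover Uw.
have [sfin sU] := sigmaP _ n Uw.
have [F [Ffin FU sF]] := finite_sub_finite_unions _ _ sfin sU.
by exists F; split=> // x /(_ _ Uw) /sF.
Qed.

End Menger.

(** * Single selections and topological countability *)

Section Rothberger.
Context {X : topologicalType}.
Implicit Types (U : set (set X)) (A : set X).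

Lemma topologically_countable_markov_Rothberger :
  topologically_countable X -> markov_Rothberger X.
Proof.
move=> [x xT].
have /choice[sigma sigmaP] : forall p : set (set X) * nat, exists V,
    is_open_cover p.1 -> p.1 V /\ V (x p.2).
  move=> [U n] /=; have [[_ /seteqP[_ Uc]]|nU] := pselect (is_open_cover U).
    by have [V UV Vx] := Uc (x n) I; exists V.
  by exists set0.
exists (fun U n => sigma (U, n)) => [U n AU|u uc].
  by have [] := sigmaP (U, n) AU.
split.
  move=> _ [n _ <-]; have [+ _] := sigmaP (u n, n) (uc n).
  by have [uo _] := uc n => /uo.
rewrite bigcup_image; apply/seteqP; split=> // y; rewrite xT => -[n _ yn].
have [uV Vx] := sigmaP (u n, n) (uc n).
by exists n => //; apply: yn; split=> //; have [uo _] := uc n; exact: uo.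
Qed.

Lemma topologically_countable_markov_omega_Rothberger :
  topologically_countable X -> markov_omega_Rothberger X.
Proof.
move=> [x xT].
(* Round [n] handles the list of indices coded by [n]; numbers that code no list yield the empty
   list. *)
pose pts n : seq X := map x (odflt [::] (unpickle n)).
have /choice[sigma sigmaP] : forall p : set (set X) * nat, exists V,
    is_omega_cover p.1 -> p.1 V /\ [set` pts p.2] `<=` V.
  move=> [U n] /=; have [/omega_coverP[_ Uw]|nU] := pselect (is_omega_cover U).
    by have [V UV sV] := Uw (pts n); exists V.
  by exists set0.
exists (fun U n => sigma (U, n)) => [U n AU|u uw].
  by have [] := sigmaP (U, n) AU.
have uo n : open (sigma (u n, n)).
  have [+ _] := sigmaP (u n, n) (uw n).
  by have [[uo _] _] := uw n => /uo.
apply/omega_coverP; split; first by move=> _ [n _ <-].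
move=> s.
have /choice[i iP] : forall y, exists i, (\bigcap_(V in open_nbhs (x i)) V) y.
  move=> y; have [i _ iy] : (\bigcup_n \bigcap_(V in open_nbhs (x n)) V) y.
    by rewrite -xT.
  by exists i.
pose n := pickle (map i s).
have [_ ptsV] := sigmaP (u n, n) (uw n).
exists (sigma (u n, n)); first by exists n.
(* An open set containing [x (i y)] contains [y], by the choice of [i]. *)
move=> y ys; apply: iP; split=> //.
by apply: ptsV; rewrite /= /pts pickleK/=; do 2 apply: map_f.
Qed.

Lemma markov_Rothberger_topologically_countable :
  markov_Rothberger X -> topologically_countable X.
Proof.
move=> /(markov_win1_cores (@subset_refl _ _))[sigma sigmaP coresT].
have /choice[x xP] : forall n, exists x,
    \bigcap_(U in open_covers X) sigma U n `<=`
    \bigcap_(V in open_nbhs x) V.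
  move=> n; apply: contrapT => nx.
  (* The answer to [U] in round [n] would be a member of [U], hence not contain the core, yet the
     core lies in every answer. *)
  pose U : set (set X) :=
    [set V | open V /\ ~ \bigcap_(U in open_covers X) sigma U n `<=` V].
  have Uc : is_open_cover U.
    split=> [V []//|]; apply/seteqP; split=> // x _.
    apply: contrapT => nUx; apply: nx; exists x => y yn V [Vo Vx].
    by apply: contrapT => nVy; apply: nUx; exists V => //; split=> // /(_ _ yn).
  by have [_] := sigmaP U n Uc; apply; exact: bigcap_inf.
exists x; apply/esym/seteqP; split=> // y; rewrite coresT => -[n _ yn].
by exists n => //; exact: xP.
Qed.

(** Pairs of a list number and a position are coded by naturals; [x0] is the value at codes out of
    range, which is where nonemptiness enters. *)
Lemma topologically_countable_seqs (s : nat -> seq X) : [set: X] !=set0 ->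
  [set: X] = \bigcup_n \bigcup_(x in [set` s n]) \bigcap_(V in open_nbhs x) V ->
  topologically_countable X.
Proof.
move=> [x0 _] sT.
pose x m := if unpickle m is Some (n, i) then nth x0 (s n) i else x0.
exists x; apply/esym/seteqP; split=> // y.
rewrite sT => -[n _ [z zs zy]].
exists (pickle (n, index z (s n))) => //.
by rewrite /x pickleK nth_index.
Qed.

Lemma markov_omega_Rothberger_topologically_countable :
  [set: X] !=set0 -> markov_omega_Rothberger X -> topologically_countable X.
Proof.
move=> X0 /(markov_win1_cores sub_omega_covers)[sigma sigmaP coresT].
(* The list [s n] comes from negating the omega-cover condition for the open sets that do not
   contain the core. *)
have /choice[s sP] : forall n, exists s : seq X, forall V, open V ->
    [set` s] `<=` V -> \bigcap_(U in omega_covers X) sigma U n `<=` V.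
  move=> n; apply: contrapT => ns.
  pose U : set (set X) :=
    [set V | open V /\ ~ \bigcap_(U in omega_covers X) sigma U n `<=` V].
  have Uw : is_omega_cover U.
    apply/omega_coverP; split=> [V []//|s].
    apply: contrapT => nUs; apply: ns; exists s => V Vo sV.
    by apply: contrapT => nV; apply: nUs; exists V.
  by have [_] := sigmaP U n Uw; apply; exact: bigcap_inf.
apply: (topologically_countable_seqs s X0).
apply/esym/seteqP; split=> // y; rewrite coresT => -[n _ yn].
(* Otherwise each [x] in [s n] has an open neighbourhood missing [y]; their union contains [s n],
   hence the core and with it [y]. *)
exists n => //; apply: contrapT => nys.
have /choice[V VP] : forall x, exists V, x \in s n -> open_nbhs x V /\ ~ V y.
  move=> x; have [xs|nxs] := pselect (x \in s n); last by exists set0.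
  apply: contrapT => nV; apply: nys; exists x => // V xV.
  by apply: contrapT => nVy; apply: nV; exists V.
have [x xs Vxy] : (\bigcup_(x in [set` s n]) V x) y.
  apply: sP yn; first by apply: bigcup_open => x /VP[[]].
  by move=> x xs; exists x => //; have [[]] := VP x xs.
by have [_] := VP x xs.
Qed.

End Rothberger.

(* Part (2) needs X to be nonempty: the empty family is an open cover of the
   empty space and P2 has no answer to it, whereas every omega-cover of the
   empty space is nonempty. *)
Theorem theorem4p17 (X : topologicalType) :
  ((markov_omega_Menger X <-> markov_Menger X) /\
   (markov_Menger X <-> sigma_relatively_compact X)) /\
  ([set: X] !=set0 ->
   (markov_omega_Rothberger X <-> markov_Rothberger X) /\
   (markov_Rothberger X <-> topologically_countable X)).
Proof.
split=> [|X0]; split; split.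
- move/markov_omega_Menger_sigma_relatively_compact.
  exact: sigma_relatively_compact_markov_Menger.
- move/markov_Menger_sigma_relatively_compact.
  exact: sigma_relatively_compact_markov_omega_Menger.
- exact: markov_Menger_sigma_relatively_compact.
- exact: sigma_relatively_compact_markov_Menger.
- move/(markov_omega_Rothberger_topologically_countable X0).
  exact: topologically_countable_markov_Rothberger.
- move/markov_Rothberger_topologically_countable.
  exact: topologically_countable_markov_omega_Rothberger.
- exact: markov_Rothberger_topologically_countable.
- exact: topologically_countable_markov_Rothberger.
Qed.
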